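(* Let $n\ge 1$. For every $2^n\times 2^n$ density matrix $\rho$, $$\frac{1}{2^{2n}}\sum_{\gamma,\delta\in\{0,1\}^n}X^\gamma Z^\delta\,\rho\,(X^\gamma Z^\delta)^\dagger=\frac{1}{2^n}I .$$ That is, the quantum one time pad, which applies $X^\gamma Z^\delta$ with $(\gamma,\delta)$ uniformly random in $\{0,1\}^n\times\{0,1\}^n$, maps every input state to the totally mixed state.
   Context: A density matrix is a positive semidefinite matrix of trace $1$. With $\sigma_x=\begin{pmatrix}0&1\\1&0\end{pmatrix}$ and $\sigma_z=\begin{pmatrix}1&0\\0&-1\end{pmatrix}$, for $\alpha,\beta\in\{0,1\}^n$ put $X^\alpha=\bigotimes_{i=1}^n\sigma_x^{\alpha(i)}$ and $Z^\beta=\bigotimes_{i=1}^n\sigma_z^{\beta(i)}$. *)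

(* Defs.v *)
From mathcomp Require Import all_boot all_order all_algebra.
From mathcomp Require Import sesquilinear spectral.
From mathcomp.real_closed Require Import mxtens.

Set Implicit Arguments.
Unset Strict Implicit.
Unset Printing Implicit Defensive.

Import Order.TTheory GRing.Theory Num.Theory.
Local Open Scope ring_scope.
Local Open Scope sesquilinear_scope.

Section QuantumOneTimePad.

(* [M ^t*], from the spectral library, is the conjugate transpose of M. *)
Variable C : numClosedFieldType.

Definition psdmx m (A : 'M[C]_m) : Prop :=
  A \is hermsymmx /\ forall v : 'cV[C]_m, 0 <= (v ^t* *m A *m v) 0 0.

Definition density_matrix m (rho : 'M[C]_m) : Prop :=
  psdmx rho /\ \tr rho = 1.

Definition sigma_x : 'M[C]_2 := block_mx (0 : 'M_1) 1 1 0.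

Definition sigma_z : 'M[C]_2 := block_mx (1 : 'M_1) 0 0 (-1).

(* A 0 (x) ... (x) A n.-1, associated to the right. [tensmx] is the Kronecker
   product, of size 2 * 2 ^ n here; the cast replaces this by 2 ^ n.+1. *)
Fixpoint bigtensmx n : ('I_n -> 'M[C]_2) -> 'M[C]_(2 ^ n) :=
  match n with
  | 0 => fun _ => 1%:M
  | n'.+1 => fun A =>
      castmx (esym (expnS 2 n'), esym (expnS 2 n'))
        (tensmx (A ord0) (bigtensmx (fun i => A (lift ord0 i))))
  end.

Definition pauliX n (alpha : {ffun 'I_n -> bool}) : 'M[C]_(2 ^ n) :=
  bigtensmx (fun i => sigma_x ^+ alpha i).

Definition pauliZ n (beta : {ffun 'I_n -> bool}) : 'M[C]_(2 ^ n) :=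
  bigtensmx (fun i => sigma_z ^+ beta i).

End QuantumOneTimePad.

(* Main.v *)
Require Import Defs.
From mathcomp Require Import all_boot all_order all_algebra.
From mathcomp Require Import sesquilinear spectral reals.
From mathcomp.real_closed Require Import complex mxtens.

Set Implicit Arguments.
Unset Strict Implicit.
Unset Printing Implicit Defensive.

Import Order.TTheory GRing.Theory Num.Theory.
Local Open Scope ring_scope.
Local Open Scope sesquilinear_scope.

(** The operators X^gamma Z^delta satisfy the orthogonality relation
    sum_P P_{ab} conj(P_{cd}) = 2^n [a = c] [b = d] on their entries. This
    relation is multiplicative under Kronecker products, so it reduces to the
    four one-qubit operators; summing it against rho_{bd} turns the left-hand
    side into sum_P P rho P^dagger and the right-hand side into
    2^n tr(rho) I. *)

Definition schur_orthogonal (C : numClosedFieldType) (I : finType) m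
    (P : I -> 'M[C]_m) : Prop :=
  forall a b c d, \sum_i P i a b * (P i c d)^* = m%:R *+ ((a == c) && (b == d)).

Lemma schur_orthogonal_twirl (C : numClosedFieldType) (I : finType) m
    (P : I -> 'M[C]_m) (M : 'M[C]_m) :
  schur_orthogonal P -> \sum_i P i *m M *m (P i)^t* = (m%:R * \tr M)%:M.
Proof.
move=> orthP; apply/matrixP => a c; rewrite summxE [RHS]mxE.
(* The sum over [i] is moved innermost, where it is exactly the left-hand side of the orthogonality
   relation. *)
transitivity (\sum_d \sum_b M b d * \sum_i P i a b * (P i c d)^*).
  transitivity (\sum_i \sum_d \sum_b P i a b * M b d * (P i c d)^*).
    apply: eq_bigr => i _; rewrite mxE; apply: eq_bigr => d _.
    by rewrite !mxE mulr_suml.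
  rewrite exchange_big; apply: eq_bigr => d _.
  rewrite exchange_big; apply: eq_bigr => b _.
  rewrite mulr_sumr; apply: eq_bigr => i _.
  by rewrite mulrA [M b d * _]mulrC.
rewrite /mxtrace mulr_sumr -sumrMnl; apply: eq_bigr => d _.
rewrite (bigD1 d) //= [X in _ + X]big1 => [|b neq_bd]; last first.
  by rewrite orthP (negbTE neq_bd) andbF mulr0n mulr0.
by rewrite orthP eqxx andbT addr0 mulrnAr mulrC.
Qed.

(** Entries of a Kronecker product are products of entries, so the sum over [I * J] factors into one
    sum for [P] and one for [Q]. *)
Lemma schur_orthogonal_tens (C : numClosedFieldType) (I J : finType) m n
    (P : I -> 'M[C]_m) (Q : J -> 'M[C]_n) :
  schur_orthogonal P -> schur_orthogonal Q ->
  schur_orthogonal (fun ij : I * J => tensmx (P ij.1) (Q ij.2)).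
Proof.
move=> orthP orthQ a b c d.
case: (mxtens_indexP a) => a1 a2; case: (mxtens_indexP b) => b1 b2.
case: (mxtens_indexP c) => c1 c2; case: (mxtens_indexP d) => d1 d2.
under eq_bigr => ij _ do rewrite !tensmxE rmorphM mulrACA.
rewrite -(pair_bigA _ (fun i j => (P i a1 b1 * (P i c1 d1)^*) *
                                   (Q j a2 b2 * (Q j c2 d2)^*))) /=.
rewrite -big_distrlr /= orthP orthQ mulrnAr mulrnAl -mulrnA -natrM mulnb.
(* The encoding of index pairs is injective, so equality of composite indices is equality in both
   components. *)
rewrite !(can_eq (@mxtens_indexK _ _)) !xpair_eqE.
by rewrite andbACA.
Qed.

Lemma schur_orthogonal_cast (C : numClosedFieldType) (I : finType) m m'
    (e : m = m') (P : I -> 'M[C]_m) :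
  schur_orthogonal P -> schur_orthogonal (fun i => castmx (e, e) (P i)).
Proof. by case: m' / e. Qed.

Lemma schur_orthogonal_reindex (C : numClosedFieldType) (I J : finType) m
    (h : J -> I) (P : I -> 'M[C]_m) :
  bijective h -> schur_orthogonal (P \o h) -> schur_orthogonal P.
Proof.
move=> bij_h orthP a b c d; rewrite -orthP.
by rewrite (reindex h) //; apply: onW_bij.
Qed.

Lemma eq_schur_orthogonal (C : numClosedFieldType) (I : finType) m
    (P Q : I -> 'M[C]_m) :
  P =1 Q -> schur_orthogonal P -> schur_orthogonal Q.
Proof.
by move=> eqPQ orthP a b c d; under eq_bigr => i _ do rewrite -eqPQ; exact: orthP.
Qed.

(** Since [sigma_z C ^+ z] is diagonal, only the summand [k = b] of the matrix product survives: a
    permutation entry times the sign at column [b]. *)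
Lemma pauli1E (C : numClosedFieldType) (x z : bool) (a b : 'I_2) :
  (sigma_x C ^+ x *m sigma_z C ^+ z) a b =
  ((a != b) == x)%:R * (-1) ^+ (z && (b != ord0)).
Proof.
have xE i j : sigma_x C i j = (i != j)%:R.
  by case: i => [[|[|[]]] //= ?]; case: j => [[|[|[]]] //= ?];
    rewrite /sigma_x mxE; case: splitP => [[[|[]] //= ?]|[[|[]] //= ?]];
    rewrite mxE; case: splitP => [[[|[]] //= ?]|[[|[]] //= ?]];
    rewrite ?mxE.
have zE i j : sigma_z C i j = (-1) ^+ (i != ord0) *+ (i == j).
  by case: i => [[|[|[]]] //= ?]; case: j => [[|[|[]]] //= ?];
    rewrite /sigma_z mxE; case: splitP => [[[|[]] //= ?]|[[|[]] //= ?]];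
    rewrite mxE; case: splitP => [[[|[]] //= ?]|[[|[]] //= ?]];
    rewrite ?mxE.
rewrite mxE (bigD1 b) //= big1 => [|k neq_kb]; last first.
  by case: z; rewrite ?expr1 ?expr0 ?zE ?mxE (negbTE neq_kb) mulr0.
rewrite addr0; case: x z => -[]; rewrite ?expr1 ?expr0 ?xE ?zE ?mxE eqxx;
  by rewrite ?eqb_id ?eqbF_neg ?negbK.
Qed.

(** The sum over [x] forces [(a != b) = (c != d)]; the sum of signs over [z] is 2 if [b = d] and
    cancels otherwise. Together they give [a = c] and [b = d]. *)
Lemma schur_orthogonal_pauli1 (C : numClosedFieldType) :
  schur_orthogonal (fun xz : bool * bool =>
    sigma_x C ^+ xz.1 *m sigma_z C ^+ xz.2).
Proof.
move=> a b c d; under eq_bigr => xz _ do rewrite !pauli1E.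
rewrite -(pair_bigA _ (fun x z : bool =>
  (((a != b) == x)%:R * (-1) ^+ (z && (b != ord0))) *
  (((c != d) == x)%:R * (-1) ^+ (z && (d != ord0)))^*)) /= !big_bool.
(* All entries are 0, 1 or -1, so conjugation disappears and sixteen index choices remain. *)
rewrite !rmorphM !rmorphXn !rmorphN !rmorph1 !rmorph_nat /=.
case: a => [[|[|[]]] //= ?]; case: b => [[|[|[]]] //= ?];
case: c => [[|[|[]]] //= ?]; case: d => [[|[|[]]] //= ?];
by rewrite -?val_eqE /= ?expr0 ?expr1 ?mul1r !(mulr0, mul0r, mulr1, mulrNN,
  addNr, addr0, add0r).
Qed.

(** Prepending at [ord0] matches the recursion of [bigtensmx], which splits off the factor at
    [ord0]. *)
Definition ffun_cons n (T : Type) (p : T * {ffun 'I_n -> T}) :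
    {ffun 'I_n.+1 -> T} :=
  [ffun i => oapp p.2 p.1 (unlift ord0 i)].

Lemma ffun_cons0 n T (p : T * {ffun 'I_n -> T}) : ffun_cons p ord0 = p.1.
Proof. by rewrite ffunE unlift_none. Qed.

Lemma ffun_consS n T (p : T * {ffun 'I_n -> T}) i :
  ffun_cons p (lift ord0 i) = p.2 i.
Proof. by rewrite ffunE liftK. Qed.

Lemma ffun_cons_bij n T : bijective (@ffun_cons n T).
Proof.
exists (fun f : {ffun 'I_n.+1 -> T} => (f ord0, [ffun i => f (lift ord0 i)])).
  move=> p; rewrite ffun_cons0 [p in RHS]surjective_pairing; congr (_, _).
  by apply/ffunP => i; rewrite ffunE ffun_consS.
move=> f; apply/ffunP => i.
by rewrite ffunE; case: unliftP => [j|] -> //=; rewrite ffunE.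
Qed.

Lemma eq_bigtensmx (C : numClosedFieldType) n (A B : 'I_n -> 'M[C]_2) :
  A =1 B -> bigtensmx A = bigtensmx B.
Proof.
elim: n A B => //= n IHn A B eqAB; rewrite eqAB.
by congr (castmx _ (tensmx _ _)); apply: IHn => i.
Qed.

Lemma bigtensmx_mul (C : numClosedFieldType) n (A B : 'I_n -> 'M[C]_2) :
  bigtensmx A *m bigtensmx B = bigtensmx (fun i => A i *m B i).
Proof.
elim: n A B => [|n IHn] A B /=; first by rewrite mulmx1.
(* After the mixed-product rule, eliminating the size equality makes every cast trivial. *)
by rewrite -IHn -tensmx_mul; case: _ / (esym (expnS 2 n)).
Qed.

(** Induction on [n] is run over strings of pairs instead of pairs of strings: the family for [n.+1]
    is then the one-qubit family tensored with the family for [n]. *)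
Lemma schur_orthogonal_pauli (C : numClosedFieldType) n :
  schur_orthogonal (fun gd : {ffun 'I_n -> bool} * {ffun 'I_n -> bool} =>
    pauliX C gd.1 *m pauliZ C gd.2).
Proof.
pose h k (f : {ffun 'I_k -> bool * bool}) :=
  ([ffun i => (f i).1], [ffun i => (f i).2]).
have bij_h k : bijective (@h k).
  exists (fun gd : {ffun 'I_k -> bool} * {ffun 'I_k -> bool} =>
            [ffun i => (gd.1 i, gd.2 i)]).
    by move=> f; apply/ffunP => i; rewrite !ffunE -surjective_pairing.
  by case=> g d; congr (_, _); apply/ffunP => i; rewrite !ffunE.
pose P (xz : bool * bool) := sigma_x C ^+ xz.1 *m sigma_z C ^+ xz.2.
apply: (schur_orthogonal_reindex (bij_h n)).
suff orthP : schur_orthogonal (fun f : {ffun 'I_n -> bool * bool} =>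
    bigtensmx (fun i => P (f i))).
  apply: eq_schur_orthogonal orthP.
  move=> f; rewrite /= bigtensmx_mul; apply: eq_bigtensmx => i.
  by rewrite !ffunE.
elim: n => [|n IHn].
  (* There is a single function on the empty type ['I_0], so the value [(true, true)] is
     arbitrary. *)
  move=> a b c d; rewrite !ord1 !eqxx /= (big_pred1 [ffun=> (true, true)]).
    by rewrite !mxE conjC1 mulr1.
  by move=> f; symmetry; apply/eqP/ffunP; case.
apply: (schur_orthogonal_reindex (@ffun_cons_bij n (bool * bool))).
apply: eq_schur_orthogonal (schur_orthogonal_cast (esym (expnS 2 n))
  (schur_orthogonal_tens (@schur_orthogonal_pauli1 C) IHn)) => -[xz f] /=.
rewrite ffun_cons0; congr (castmx _ (tensmx _ _)).
by apply: eq_bigtensmx => i; rewrite ffun_consS.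
Qed.

Theorem mainTheorem2 (R : realType) (n : nat) (hn : (0 < n)%N)
    (rho : 'M[R[i]]_(2 ^ n)) (hrho : density_matrix rho) :
  (2%:R ^+ (2 * n))^-1 *:
    (\sum_(gamma : {ffun 'I_n -> bool}) \sum_(delta : {ffun 'I_n -> bool})
       (pauliX R[i] gamma *m pauliZ R[i] delta) *m rho
         *m (pauliX R[i] gamma *m pauliZ R[i] delta) ^t*)
  = (2%:R ^+ n)^-1 *: 1%:M.
Proof.
rewrite pair_bigA (schur_orthogonal_twirl rho (@schur_orthogonal_pauli _ n)).
(* With trace 1 the twirl is [2 ^ n] times the identity, which cancels one of the two factors in
   [2 ^ (n + n)]. *)
case: hrho => _ ->; rewrite mulr1 natrX -scalemx1 scalerA mul2n -addnn exprD.
by rewrite invfM mulfVK // expf_neq0 // pnatr_eq0.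
Qed.
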